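(* Let $I$ be a regular icosahedron with edge length $\ell$ and center $O$, with vertices labeled $N,S,U_1,\dots,U_5,L_1,\dots,L_5$ as described in the context, and let $\mathcal{F}$ be the set of the ten triangles $F_S(i)=\triangle(S,U_i,L_i)$ and $F_N(i)=\triangle(N,U_i,L_{i-1})$, $i=1,\dots,5$ (with $L_0:=L_5$). Let $\Pi$ be the plane through $O$ perpendicular to the line $NS$, and for $F\in\mathcal{F}$ let $p(F)$ be the midpoint of the cross-edge of $F$ (the edge of $F$ not incident to its pole). Then the set $\{p(F)\mid F\in\mathcal{F}\}$ is contained in $\Pi$ and consists of ten points lying on a single circle centered at $O$, forming the vertices of a regular decagon with $36^\circ$ angular spacing.
   Context: $I$ is a regular icosahedron in $\mathbb{R}^3$ with edge length $\ell>0$ and center $O$. Its 12 vertices are labeled $V=\{N,S,U_1,\dots,U_5,L_1,\dots,L_5\}$, with indices taken modulo $5$. Here $N$ and $S$ are opposite vertices (the poles), and the line $NS$ is called the rotation axis. The vertices $U_1,\dots,U_5$ (upper ring) are the five neighbors of $N$, labeled cyclically so that $U_i$ is adjacent to $U_{i+1}$; the vertices $L_1,\dots,L_5$ (lower ring) are the five neighbors of $S$, labeled cyclically so that $L_i$ is adjacent to $L_{i+1}$; and the lower-ring vertices adjacent to $U_i$ are exactly $L_i$ and $L_{i-1}$. ''Adjacent'' means joined by an edge of the icosahedron. $\triangle(A,B,C)$ denotes the triangle with vertices $A,B,C$. The equatorial plane is $\Pi=\{x\in\mathbb{R}^3:(x-O)\cdot(N-S)=0\}$. The pole of $F_S(i)$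 is $S$ and the pole of $F_N(i)$ is $N$. The cross-edge $c(F)$ of a face $F\in\mathcal{F}$ is the edge of $F$ not incident to its pole, so $c(F_S(i))=U_iL_i$ and $c(F_N(i))=U_iL_{i-1}$, and $p(F)$ is the midpoint of $c(F)$. *)

(* Defs.v *)
From HB Require Import structures.
From mathcomp Require Import all_boot all_order all_algebra.
From mathcomp Require Import all_classical all_reals all_analysis.

Set Implicit Arguments.
Unset Strict Implicit.
Unset Printing Implicit Defensive.

Import Order.TTheory GRing.Theory Num.Theory.

Local Open Scope classical_set_scope.
Local Open Scope ring_scope.
Local Open Scope card_scope.

(* The library norm on 'rV[R]_n is the sup norm, hence the Euclidean structure
   below. *)
Section Euclidean.
Context {R : realType} {n : nat}.
Implicit Types (u v x y : 'rV[R]_n) (A C F : set 'rV[R]_n).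

Definition dot u v : R := \sum_(i < n) u 0 i * v 0 i.

Definition enorm u : R := Num.sqrt (dot u u).

Definition edist x y : R := enorm (x - y).

Definition angle u v : R := acos (dot u v / (enorm u * enorm v)).

Definition midpoint x y : 'rV[R]_n := 2^-1 *: (x + y).

Definition convex_hull A : set 'rV[R]_n := smallest (@convex_set R _) A.

Definition affinely_independent k (p : 'I_k.+1 -> 'rV[R]_n) : bool :=
  row_free (\matrix_(i < k) (p (lift ord0 i) - p ord0)).

Definition has_affine_dim A (k : nat) : Prop :=
  (exists p : 'I_k.+1 -> 'rV[R]_n, (forall i, A (p i)) /\ affinely_independent p)
  /\ ~ (exists p : 'I_k.+2 -> 'rV[R]_n,
          (forall i, A (p i)) /\ affinely_independent p).

(* Faces in the sense of convex geometry (extreme convex subsets); for a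
   polytope these are its vertices, edges, facets, etc., together with set0 and
   the polytope itself. *)
Definition is_face C F : Prop :=
  [/\ F `<=` C, convex_set F &
      forall x y (t : R), C x -> C y -> 0 < t < 1 ->
        F (t *: x + (1 - t) *: y) -> F x /\ F y].

Definition is_kface C (k : nat) F : Prop := is_face C F /\ has_affine_dim F k.

Definition is_vertex C x : Prop := is_kface C 0 [set x].

Definition adjacent C x y : Prop := is_kface C 1 (convex_hull [set x; y]).

Definition is_isometry (g : 'rV[R]_n -> 'rV[R]_n) : Prop :=
  forall x y, edist (g x) (g y) = edist x y.

Definition is_symmetry C (g : 'rV[R]_n -> 'rV[R]_n) : Prop :=
  is_isometry g /\ g @` C = C.

Definition is_polytope C : Prop :=
  (exists2 A, finite_set A & C = convex_hull A) /\ has_affine_dim C n.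

(* q lists the vertices in cyclic order; the orthonormal pair e1, e2 spans the
   plane of the polygon, so a polygon may lie in any plane through c. *)
Definition is_regular_polygon m (c : 'rV[R]_n) (r : R) (q : 'I_m -> 'rV[R]_n)
    : Prop :=
  [/\ (2 < m)%N, 0 < r &
    exists e1 e2 : 'rV[R]_n,
      [/\ dot e1 e1 = 1, dot e2 e2 = 1, dot e1 e2 = 0 &
        forall k : 'I_m,
          let theta := 2 * pi * k%:R / m%:R in
          q k = c + r *: (cos theta *: e1 + sin theta *: e2)]].

End Euclidean.

Section Icosahedron.
Context {R : realType}.
Notation pt := 'rV[R]_3.
Implicit Types (I : set pt) (l : R) (O N S : pt) (U L : 'Z_5 -> pt).

Record is_flag I (F0 F1 F2 : set pt) : Prop := {
  flag_vertex : is_kface I 0 F0;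
  flag_edge : is_kface I 1 F1;
  flag_facet : is_kface I 2 F2;
  flag_sub01 : F0 `<=` F1;
  flag_sub12 : F1 `<=` F2 }.

Definition is_regular_polyhedron I : Prop :=
  is_polytope I /\
  forall F0 F1 F2 G0 G1 G2 : set pt,
    is_flag I F0 F1 F2 -> is_flag I G0 G1 G2 ->
    exists g : pt -> pt,
      [/\ is_symmetry I g, g @` F0 = G0, g @` F1 = G1 & g @` F2 = G2].

Definition is_equilateral_triangle l (F : set pt) : Prop :=
  exists a b c : pt,
    [/\ F = convex_hull [set a; b; c],
        edist a b = l, edist b c = l & edist c a = l].

Definition is_regular_icosahedron I l : Prop :=
  [/\ is_regular_polyhedron I,
      [set F | is_kface I 2 F] #= `I_20 &
      forall F, is_kface I 2 F -> is_equilateral_triangle l F].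

(* The circumcentre, which is unique since I is full-dimensional. *)
Definition is_center I O : Prop :=
  forall x y, is_vertex I x -> is_vertex I y -> edist O x = edist O y.

(* Ring indices live in 'Z_5, so that i + 1 and i - 1 are taken modulo 5. *)
Record is_labelling I O N S U L : Prop := {
  label_vertices :
    [set x | is_vertex I x] = [set N; S] `|` range U `|` range L;
  label_distinct : uniq [:: N, S & codom U ++ codom L];
  label_opposite : midpoint N S = O;
  label_upper : forall x, adjacent I N x <-> range U x;
  label_lower : forall x, adjacent I S x <-> range L x;
  label_upper_cycle : forall i, adjacent I (U i) (U (i + 1));
  label_lower_cycle : forall i, adjacent I (L i) (L (i + 1));
  label_cross : forall i j, adjacent I (U i) (L j) <-> (j = i \/ j = i - 1) }.

Record triangle := Triangle { pole : pt; cross_edge : pt * pt }.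

Definition F_S S U L (i : 'Z_5) : triangle := Triangle S (U i, L i).
Definition F_N N U L (i : 'Z_5) : triangle := Triangle N (U i, L (i - 1)).

Definition triangle_family N S U L : set triangle :=
  range (F_S S U L) `|` range (F_N N U L).

Definition cross_midpoint (F : triangle) : pt :=
  midpoint (cross_edge F).1 (cross_edge F).2.

Definition equatorial_plane O N S : set pt := [set x | dot (x - O) (N - S) = 0].

Definition circle (Pl : set pt) (c : pt) (r : R) : set pt :=
  Pl `&` [set x | edist c x = r].

Definition degrees (d : nat) : R := d%:R * pi / 180.

End Icosahedron.

(* Main.v *)
Require Import Defs.
From HB Require Import structures.
From mathcomp Require Import all_boot all_order all_algebra.
From mathcomp Require Import all_classical all_reals all_analysis.
From mathcomp Require Import ring lra.

(** Put O at the origin, and write a for the common squared length of the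
    vertices and c for the common dot product of two adjacent vertices.  The
    ten ring vertices, read in the zigzag order U 0, L 0, U 1, L 1, ... as
    z 0, z 1, z 2, ..., satisfy
      [z k . z k = a],  [z k . z k.+1 = z k . z k.+2 = c],
    and the dot product of z k with N is c or - c according to the parity
    of k.  Hence the midpoint w k of z k and z k.+1, which runs through all
    midpoints of cross-edges, is orthogonal to N.

    In the equatorial plane the projection of z k.+2 is the reflection of the
    projection of z k in the line of that of z k.+1 (lemma [zigzag_step]), so
      [w k.+2 = 2 t w k.+1 - w k]  with  [t = c / (a - c)],
    which is the recurrence of a rotation with cosine t.  Compatibility with
    [z k . z k.+2 = c] gives [4 t^2 - 2 t - 1 = 0], so the angle is 36 or 108
    degrees ([golden_cos]).  The second value is realised by the great
    icosahedron, whose vertices satisfy the same metric relations; it need not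
    be excluded, because 1 and 3 are both invertible modulo 10 and so either
    rotation runs through the ten vertices of one regular decagon.

    The metric relations require that adjacent vertices be at distance l,
    whereas the hypotheses give l as the side of the triangular facets.  The
    bridge is that every edge of a polytope in space lies in a facet
    ([edge_facet]): among the supporting planes through the edge one takes an
    extreme position of a plane turning about the edge.  The ends of the edge
    are extreme points of the polytope, hence corners of the triangle
    ([adjacent_edist]). *)

Set Implicit Arguments.
Unset Strict Implicit.
Unset Printing Implicit Defensive.

Import Order.TTheory GRing.Theory Num.Theory.

Local Open Scope classical_set_scope.
Local Open Scope ring_scope.
Local Open Scope card_scope.

(* The analysis library has other notions with these two names. *)
Local Notation edist := Defs.edist.
Local Notation adjacent := Defs.adjacent.

(** * Dot, cross and triple products in space *)

Section DotProduct.
Context {R : realType} {n : nat}.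
Implicit Types (u v w x y : 'rV[R]_n).

Lemma dotC u v : dot u v = dot v u.
Proof. by apply: eq_bigr => i _; rewrite mulrC. Qed.

Lemma dotDl u v w : dot (u + v) w = dot u w + dot v w.
Proof. by rewrite -big_split; apply: eq_bigr => i _; rewrite mxE mulrDl. Qed.

Lemma dotZl a u w : dot (a *: u) w = a * dot u w.
Proof. by rewrite /dot mulr_sumr; apply: eq_bigr => i _; rewrite mxE mulrA. Qed.

Lemma dotDr u v w : dot u (v + w) = dot u v + dot u w.
Proof. by rewrite dotC dotDl !(dotC u). Qed.

Lemma dotZr a u w : dot u (a *: w) = a * dot u w.
Proof. by rewrite dotC dotZl dotC. Qed.

Lemma dotNl u w : dot (- u) w = - dot u w.
Proof. by rewrite -scaleN1r dotZl mulN1r. Qed.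

Lemma dotNr u w : dot u (- w) = - dot u w.
Proof. by rewrite dotC dotNl dotC. Qed.

Lemma dot0l w : dot 0 w = 0.
Proof. by rewrite -(scale0r 0) dotZl mul0r. Qed.

Definition dotE := (dotDl, dotDr, dotNl, dotNr, dotZl, dotZr).

Lemma dot_ge0 u : 0 <= dot u u.
Proof. by apply: sumr_ge0 => i _; rewrite -expr2 sqr_ge0. Qed.

Lemma dot_eq0 u : dot u u = 0 -> u = 0.
Proof.
move=> /eqP; rewrite psumr_eq0 => [/allP u0|i _]; last first.
  by rewrite -expr2 sqr_ge0.
apply/rowP => i; rewrite mxE; apply/eqP.
by have := u0 i; rewrite mem_index_enum mulf_eq0 orbb => /(_ isT).
Qed.

Lemma dot_gt0 u : u != 0 -> 0 < dot u u.
Proof.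
by move=> u0; rewrite lt0r dot_ge0 andbT; apply: contra_neq u0; exact: dot_eq0.
Qed.

Lemma edistC x y : edist x y = edist y x.
Proof. by rewrite /Defs.edist /enorm -opprB dotNl dotNr opprK. Qed.

Lemma edist_sqr x y : edist x y ^+ 2 = dot (x - y) (x - y).
Proof. by rewrite sqr_sqrtr ?dot_ge0. Qed.

End DotProduct.

Section CrossProduct.
Context {R : realType}.
Notation pt := 'rV[R]_3.
Implicit Types (u v w x d : pt).

Definition cross u v : pt := \row_(i < 3)
  nth 0 [:: u 0 1 * v 0 2 - u 0 2 * v 0 1;
            u 0 2 * v 0 0 - u 0 0 * v 0 2;
            u 0 0 * v 0 1 - u 0 1 * v 0 0] i.

Definition triple u v w : R := dot (cross u v) w.

Lemma dot3 u v : dot u v = u 0 0 * v 0 0 + u 0 1 * v 0 1 + u 0 2 * v 0 2.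
Proof.
rewrite /dot !big_ord_recl big_ord0 addr0 addrA.
by do 2?[congr (_ + _)]; congr (u _ _ * v _ _); apply: val_inj.
Qed.

Lemma row3P u v : u 0 0 = v 0 0 -> u 0 1 = v 0 1 -> u 0 2 = v 0 2 -> u = v.
Proof.
move=> e0 e1 e2; apply/rowP => -[[|[|[|//]]] lti].
- by rewrite (_ : Ordinal lti = 0); [exact: e0|exact: val_inj].
- by rewrite (_ : Ordinal lti = 1); [exact: e1|exact: val_inj].
- by rewrite (_ : Ordinal lti = 2); [exact: e2|exact: val_inj].
Qed.

Lemma tripleC u v w : triple u w v = - triple u v w.
Proof. by rewrite /triple !dot3 !mxE /=; ring. Qed.

Lemma triple_rot u v w : triple u v w = triple v w u.
Proof. by rewrite /triple !dot3 !mxE /=; ring. Qed.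

Lemma triple_same u v : triple u v u = 0.
Proof. by rewrite /triple !dot3 !mxE /=; ring. Qed.

(** Cramer's rule cleared of denominators, hence valid for dependent vectors
    too. *)
Lemma cramer3 d u v w :
  triple d v w *: u + triple d w u *: v + triple d u v *: w
  = triple u v w *: d.
Proof.
by apply: row3P; rewrite !mxE; rewrite /triple !dot3 !mxE /=; ring.
Qed.

Lemma crossDr d u v : cross d (u + v) = cross d u + cross d v.
Proof. by apply: row3P; rewrite !mxE /=; ring. Qed.

Lemma crossZr d a u : cross d (a *: u) = a *: cross d u.
Proof. by apply: row3P; rewrite !mxE /=; ring. Qed.

Lemma cross0r d : cross d 0 = 0.
Proof. by rewrite -(scale0r d) crossZr !scale0r. Qed.

Lemma crossC u v : cross u v = - cross v u.
Proof. by apply: row3P; rewrite !mxE /=; ring. Qed.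

Lemma crossvv u : cross u u = 0.
Proof. by apply: row3P; rewrite !mxE /=; ring. Qed.

Lemma cross_cross d u : cross d (cross d u) = dot d u *: d - dot d d *: u.
Proof. by apply: row3P; rewrite !mxE !dot3 /=; ring. Qed.

Lemma cross_eq0 d u : d != 0 -> cross d u = 0 -> u = (dot d u / dot d d) *: d.
Proof.
move=> d0 du; have dd0 : dot d d != 0 by rewrite gt_eqF ?dot_gt0.
have := cross_cross d u; rewrite du cross0r.
move=> /esym/eqP; rewrite subr_eq0 => /eqP ddu.
by rewrite mulrC -scalerA ddu scalerA mulVf ?scale1r.
Qed.

Lemma cross_all_eq0 d : (forall u, cross d u = 0) -> d = 0.
Proof.
move=> d0.
have /rowP e0 := d0 (delta_mx 0 0); have /rowP e1 := d0 (delta_mx 0 1).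
have := e0 1; have := e0 2; have := e1 2; rewrite !mxE /=.
rewrite !mulr1 !mulr0 !subr0 add0r => d00 /eqP.
rewrite oppr_eq0 => /eqP d01 d02.
by apply: row3P; rewrite mxE.
Qed.

(** By Cramer's rule [x] is, up to a nonzero factor, a combination of the three
    vectors, so it is orthogonal to itself. *)
Lemma orthogonal3_eq0 x u v w :
  triple u v w != 0 -> dot x u = 0 -> dot x v = 0 -> dot x w = 0 -> x = 0.
Proof.
move=> uvw0 xu xv xw; have cr := cramer3 x u v w.
apply: dot_eq0; apply: (mulfI uvw0).
by rewrite mulr0 -dotZr -cr !dotE xu xv xw !mulr0 !addr0.
Qed.

(** The Gram determinant, expanded along its first row. *)
Lemma triple_gram u v w : triple u v w ^+ 2 =
  dot u u * (dot v v * dot w w - dot v w ^+ 2)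
  - dot u v * (dot u v * dot w w - dot v w * dot u w)
  + dot u w * (dot u v * dot v w - dot v v * dot u w).
Proof. by rewrite /triple !dot3 !mxE /=; ring. Qed.

End CrossProduct.

(** * Convex sets, hulls and faces *)

Section Convexity.
Context {R : realType} {n : nat}.
Notation pt := 'rV[R]_n.
Implicit Types (A B C F : set pt) (x y z g : pt) (t k : R).

Lemma convex_comb A x y t : convex_set A -> A x -> A y -> 0 <= t <= 1 ->
  A (t *: x + (1 - t) *: y).
Proof.
move=> cA Ax Ay /andP[t0 t1].
by have := cA x y (Itv01 t0 t1) (mem_set Ax) (mem_set Ay); rewrite inE.
Qed.

Lemma convex_setP A : convex_set A <->
  forall x y t, A x -> A y -> 0 < t < 1 -> A (t *: x + (1 - t) *: y).
Proof.
split=> [cA x y t Ax Ay /andP[t0 t1]|cA].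
  by apply: convex_comb => //; rewrite !ltW.
apply/convex_setW => x y; rewrite !inE => Ax Ay k k0 k1.
by apply/mem_set/cA => //; rewrite k0 k1.
Qed.

Lemma convex_setI A B : convex_set A -> convex_set B -> convex_set (A `&` B).
Proof.
move=> cA cB; apply/convex_setP => x y t [Ax Bx] [Ay By] /andP[t0 t1].
by split; apply: convex_comb; rewrite ?ltW.
Qed.

Lemma convex_halfspace g k : convex_set [set z : pt | k <= dot z g].
Proof.
apply/convex_setP => x y t /= kx ky /andP[t0 t1]; rewrite !dotE.
by nra.
Qed.

Lemma convex_hyperplane g k : convex_set [set z : pt | dot z g = k].
Proof.
by apply/convex_setP => x y t /= kx ky _; rewrite !dotE kx ky; ring.
Qed.

Lemma convex_hull_convex A : convex_set (convex_hull A).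
Proof.
apply/convex_setP => x y t Ax Ay /andP[t0 t1] B [cB AB].
by apply: convex_comb; [|exact: Ax|exact: Ay|rewrite !ltW].
Qed.

(** Removing an extreme point from a convex set leaves it convex; so if [x] were
    not a generator, the hull without [x] would be a smaller convex set that
    still contains the generators. *)
Lemma extreme_in_generators C A x :
  is_face C [set x] -> convex_hull A `<=` C -> convex_hull A x -> A x.
Proof.
move=> [_ _ xC] AC Ax; apply: contrapT => nAx.
have cAx : convex_set (convex_hull A `\ x).
  apply/convex_setP => y z t [Ay /= yx] [Az zx] t01; split=> [|/= e].
    apply: convex_comb => //; first exact: convex_hull_convex.
    by case/andP: t01 => t0 t1; rewrite !ltW.
  by have [] := xC y z t (AC _ Ay) (AC _ Az) t01 e.
have [] := smallest_sub cAx _ Ax; last by move=> _ /=; apply.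
move=> a Aa; split; first exact: sub_gen_smallest.
by move=> /= ax; apply: nAx; rewrite -ax.
Qed.

Lemma face_supporting C g k : convex_set C -> (forall z, C z -> k <= dot z g) ->
  is_face C (C `&` [set z | dot z g = k]).
Proof.
move=> cC kC; split; first by move=> z [].
  by apply: convex_setI => //; exact: convex_hyperplane.
move=> x y t Cx Cy /andP[t0 t1] [_ /=]; rewrite !dotE => e.
have kx := kC _ Cx; have ky := kC _ Cy.
by split; split=> //=; apply/eqP; rewrite eq_le ?kx ?ky andbT; nra.
Qed.

End Convexity.

Section SpaceDimension.
Context {R : realType}.
Notation pt := 'rV[R]_3.
Implicit Types (A I F : set pt) (x y z g d : pt).

(** The differences of the four points form an invertible matrix, and a common
    height over the plane orthogonal to [g] means that it kills [g]. *)
Lemma aff_indep_not_coplanar (p : 'I_4 -> pt) g k :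
  affinely_independent p -> (forall i, dot (p i) g = k) -> g = 0.
Proof.
rewrite /affinely_independent; set M := (\matrix_(i < 3) _).
move=> Mfree pg; have Mu : M \in unitmx by rewrite -row_free_unit.
suff Mg : M *m g^T = 0.
  by apply: trmx_inj; rewrite -(mulKmx Mu g^T) Mg mulmx0 trmx0.
apply/matrixP => i j; rewrite !mxE ord1.
transitivity (dot (p (lift ord0 i) - p ord0) g).
  by apply: eq_bigr => m _; rewrite !mxE.
by rewrite dotDl dotNl !pg subrr.
Qed.

Lemma aff_indep_neq k (p : 'I_k.+2 -> pt) :
  affinely_independent p -> exists i j, p i != p j.
Proof.
move=> pfree; exists (lift ord0 ord0), ord0; apply: contraL pfree => /eqP e.
rewrite /affinely_independent; apply/negP => Mfree.
have := row_free_inj Mfree; move=> /(_ _ (delta_mx 0 ord0 : 'rV_k.+1) 0).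
rewrite mul0mx -rowE rowK e subrr => /(_ erefl) /matrixP /(_ 0 ord0).
by rewrite !mxE !eqxx => /eqP; rewrite oner_eq0.
Qed.

Lemma convex_line d x : convex_set [set z | cross d (z - x) = 0].
Proof.
apply/convex_setP => u v t /= u0 v0 _.
rewrite (_ : _ - x = t *: (u - x) + (1 - t) *: (v - x)).
  by rewrite crossDr !crossZr u0 v0 !scaler0 addr0.
by apply/rowP => i; rewrite !mxE; ring.
Qed.

Lemma aff_indep3 (p : 'I_3 -> pt) :
  cross (p 1 - p 0) (p 2 - p 0) != 0 -> affinely_independent p.
Proof.
move=> c0; apply: inj_row_free => v vM.
set d := p 1 - p 0 in c0; set w := p 2 - p 0 in c0.
have e : v 0 0 *: d + v 0 1 *: w = 0.
  rewrite -vM; apply/rowP => j; rewrite !mxE !big_ord_recl big_ord0 addr0 !mxE.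
  by congr (v _ _ * (p _ _ _ - p _ _ _) + v _ _ * (p _ _ _ - p _ _ _));
    apply: val_inj.
have v1 : v 0 1 = 0.
  have := congr1 (cross d) e.
  rewrite crossDr !crossZr crossvv scaler0 add0r cross0r => /eqP.
  by rewrite scaler_eq0 (negPf c0) orbF => /eqP.
have v0 : v 0 0 = 0.
  have := congr1 (cross w) e.
  rewrite crossDr !crossZr crossvv scaler0 addr0 cross0r => /eqP.
  by rewrite scaler_eq0 crossC oppr_eq0 (negPf c0) orbF => /eqP.
apply/rowP => -[[|[|//]] lti]; rewrite mxE.
- by rewrite (_ : Ordinal lti = 0); [exact: v0|exact: val_inj].
- by rewrite (_ : Ordinal lti = 1); [exact: v1|exact: val_inj].
Qed.

End SpaceDimension.

(** * Every edge of a polytope in space lies in a facet *)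

Lemma total_preorder_min (T : eqType) (P : pred T) (r : rel T) (s : seq T) :
  {in P & &, forall a b c, r a b -> r b c -> r a c} ->
  {in P &, forall a b, r a b || r b a} ->
  has P s -> exists2 m, m \in s & P m /\ forall a, a \in s -> P a -> r m a.
Proof.
move=> rT rtot; elim: s => [//|x s IHs] /=.
have rxx y : P y -> r y y by move=> Py; have := rtot y y Py Py; rewrite orbb.
have [Ps _|/hasPn nPs] := boolP (has P s).
  have [m ms [Pm mmin]] := IHs Ps.
  have [Px|nPx] := boolP (P x); last first.
    exists m; first by rewrite inE ms orbT.
    split=> // a; rewrite inE => /predU1P[-> Px|]; last exact: mmin.
    by rewrite Px in nPx.
  have [rmx|rmx] := boolP (r m x).
    exists m; first by rewrite inE ms orbT.
    by split=> // a; rewrite inE => /predU1P[-> //|]; exact: mmin.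
  have rxm : r x m by have := rtot x m Px Pm; rewrite (negPf rmx) orbF.
  exists x; first by rewrite inE eqxx.
  split=> // a; rewrite inE => /predU1P[-> _|as_ Pa]; first exact: rxx.
  by apply: (rT x m a) => //; exact: mmin.
rewrite orbF => Px; exists x; first by rewrite inE eqxx.
split=> // a; rewrite inE => /predU1P[-> _|as_ Pa]; first exact: rxx.
by have := nPs a as_; rewrite Pa.
Qed.

Section EdgeInFacet.
Context {R : realType}.
Notation pt := 'rV[R]_3.
Implicit Types (A I F : set pt) (x y z a b c d : pt).

Section FixedEdge.
Variables (I : set pt) (x y : pt).
Hypothesis cI : convex_set I.
Hypothesis face_xy : is_face I (convex_hull [set x; y]).
Hypothesis xNy : x != y.
Let d := y - x.

Let d_neq0 : d != 0. Proof. by rewrite subr_eq0 eq_sym. Qed.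

Let edge_x : convex_hull [set x; y] x.
Proof. by apply: sub_gen_smallest; left. Qed.

Let edge_y : convex_hull [set x; y] y.
Proof. by apply: sub_gen_smallest; right. Qed.

Let edge_sub : convex_hull [set x; y] `<=` I.
Proof. by case: face_xy. Qed.

Let edge_on_line z : convex_hull [set x; y] z -> cross d (z - x) = 0.
Proof.
apply: (smallest_sub (@convex_line _ d x)).
by move=> _ [->|->] /=; rewrite ?subrr ?cross0r ?crossvv.
Qed.

(** An extreme convex set contains every point of the body that lies on its
    affine hull. *)
Let on_line_edge z : I z -> cross d (z - x) = 0 -> convex_hull [set x; y] z.
Proof.
move=> Iz /(cross_eq0 d_neq0); set k := _ / _ => ez.
have {ez} zE : z = x + k *: (y - x) by rewrite -/d -ez addrC subrK.
have [_ _ ext] := face_xy.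
have [k0|k0] := ltP k 0.
  have k1 : 0 < 1 - k by lra.
  have t01 : 0 < (1 - k)^-1 < 1.
    by rewrite invr_gt0 k1 invf_lt1 //; lra.
  have [] // := ext z y _ Iz (edge_sub edge_y) t01.
  rewrite (_ : _ + _ = x) // zE.
  by apply/rowP => i; rewrite !mxE; field; rewrite gt_eqF.
have [k1|k1] := ltP 1 k.
  have k_gt0 : 0 < k by lra.
  have t01 : 0 < k^-1 < 1 by rewrite invr_gt0 k_gt0 invf_lt1.
  have [] // := ext z x _ Iz (edge_sub edge_x) t01.
  rewrite (_ : _ + _ = y) // zE.
  by apply/rowP => i; rewrite !mxE; field; rewrite gt_eqF.
rewrite zE (_ : _ + _ = k *: y + (1 - k) *: x).
  by apply: convex_comb; rewrite ?k0 //; exact: convex_hull_convex.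
by apply/rowP => i; rewrite !mxE; ring.
Qed.

(** The cone spanned by the body at the edge contains no line outside the
    direction of the edge: a positive combination that returns to the line of
    the edge would be a point of the edge, so its terms would be there too. *)
Let pointed a b c (al be ga : R) : I a -> I b -> I c ->
  0 <= al -> 0 < be -> 0 <= ga ->
  cross d (al *: (a - x) + be *: (b - x) + ga *: (c - x)) = 0 ->
  cross d (b - x) = 0.
Proof.
move=> Ia Ib Ic al0 be0 ga0 e0.
have [ag0|ag0] := eqVneq (al + ga) 0.
  have [al_eq0 ga_eq0] : al = 0 /\ ga = 0 by split; lra.
  move: e0; rewrite al_eq0 ga_eq0 !scale0r add0r addr0 crossZr => /eqP.
  by rewrite scaler_eq0 gt_eqF //= => /eqP.
have ag : 0 < al + ga by rewrite lt0r ag0 addr_ge0.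
pose r := (al / (al + ga)) *: a + (1 - al / (al + ga)) *: c.
have Ir : I r.
  apply: convex_comb => //; rewrite divr_ge0 ?(ltW ag) //=.
  by rewrite ler_pdivrMr // mul1r lerDl.
have s0 : 0 < al + be + ga by lra.
have t01 : 0 < be / (al + be + ga) < 1.
  by rewrite divr_gt0 // ltr_pdivrMr //; lra.
have [_ _ ext] := face_xy.
suff : convex_hull [set x; y]
    (be / (al + be + ga) *: b + (1 - be / (al + be + ga)) *: r).
  by move=> /(ext _ _ _ Ib Ir t01)[/edge_on_line].
apply: on_line_edge.
  by apply: convex_comb; case/andP: t01 => ? ?; rewrite ?ltW.
rewrite (_ : _ - x = (al + be + ga)^-1 *:
    (al *: (a - x) + be *: (b - x) + ga *: (c - x))).
  by rewrite crossZr e0 scaler0.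
by apply/rowP => i; rewrite !mxE; field; rewrite gt_eqF //=.
Qed.

(** For two generators [a] and [b] of [I] off the line of the edge, the sign of
    [triple d (a - x) (b - x)] tells on which side of the plane of the edge and
    [a] the point [b] lies.  By [pointed] this compares the half-planes through
    the edge as angles below 180 degrees are compared, so a minimal generator
    exists; its plane supports [I] and cuts out the facet. *)
Lemma edge_facet (s : seq pt) : I = convex_hull [set` s] ->
  has_affine_dim I 3 ->
  exists2 F, is_kface I 2 F & convex_hull [set x; y] `<=` F.
Proof.
move=> IE [[p [Ip pfree]] _].
have sI z : z \in s -> I z by move=> zs; rewrite IE; exact: sub_gen_smallest.
pose P := [pred a : pt | (a \in s) && (cross d (a - x) != 0)].
pose r a b := 0 <= triple d (a - x) (b - x).
have rtrans : {in P & &, forall a b c, r a b -> r b c -> r a c}.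
  move=> a b c /andP[/sI Ia _] /andP[/sI Ib nb] /andP[/sI Ic _].
  rewrite /r => ab bc; rewrite leNgt; apply/negP => ac.
  (* Otherwise Cramer's relation is a positive combination as in pointed. *)
  move/eqP: nb; apply.
  apply: (pointed (be := triple d (c - x) (a - x)) Ia Ib Ic bc _ ab).
    by rewrite tripleC oppr_gt0.
  by rewrite cramer3 crossZr crossvv scaler0.
have rtotal : {in P &, forall a b, r a b || r b a}.
  move=> a b _ _; rewrite /r [X in _ || (0 <= X)]tripleC oppr_ge0.
  exact: le_total.
(* If all generators were on one line, so would be the whole of I. *)
have hasP_s : has P s.
  apply/negP => /negP/hasPn nP.
  have I_line z : I z -> cross d (z - x) = 0.
    rewrite IE; apply: (smallest_sub (@convex_line _ d x)).
    by move=> a /= as_; have := nP a as_; rewrite /= as_ negbK => /eqP.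
  have perp u : cross d u = 0.
    apply: (aff_indep_not_coplanar (k := dot x (cross d u)) pfree) => i.
    apply/eqP; rewrite -subr_eq0 -dotNl -dotDl dotC -[dot _ _]/(triple d u _).
    by rewrite tripleC /triple I_line // dot0l oppr0.
  by move/eqP: d_neq0; apply; exact: cross_all_eq0.
have [m ms [Pm mmin]] := total_preorder_min rtrans rtotal hasP_s.
pose g := cross d (m - x).
have g0 : g != 0 by case/andP: Pm.
have yF : dot y g = dot x g.
  apply/eqP; rewrite -subr_eq0 -dotNl -dotDl dotC; apply/eqP.
  exact: triple_same.
have mF : dot m g = dot x g.
  apply/eqP; rewrite -subr_eq0 -dotNl -dotDl dotC -[dot _ _]/(triple d _ _).
  by rewrite triple_rot triple_rot triple_same.
have support z : I z -> dot x g <= dot z g.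
  rewrite IE; apply: (@smallest_sub _ _ _ [set z | dot x g <= dot z g]).
    exact: convex_halfspace.
  move=> b /= bs; rewrite -subr_ge0 -dotNl -dotDl dotC.
  have [bl|nbl] := eqVneq (cross d (b - x)) 0.
    by rewrite -[dot _ _]/(triple d _ _) tripleC /triple bl dot0l oppr0.
  by apply: mmin => //; apply/andP.
have faceF := face_supporting cI support.
exists (I `&` [set z | dot z g = dot x g]); last first.
  apply: smallest_sub; first by case: faceF.
  by move=> _ [->|->]; split=> //; exact: edge_sub.
split=> //; split.
  exists (fun i : 'I_3 => nth x [:: x; y; m] i); split; last exact: aff_indep3.
  move=> [[|[|[|//]]] lti]; split=> //=.
  - exact: edge_sub.
  - exact: edge_sub.
  - exact: sI.
move=> [q [Fq qfree]]; move/eqP: g0; apply.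
by apply: (aff_indep_not_coplanar (k := dot x g) qfree) => i; case: (Fq i).
Qed.

End FixedEdge.
End EdgeInFacet.

Section AdjacentDistance.
Context {R : realType}.
Implicit Types (I F : set 'rV[R]_3) (x y : 'rV[R]_3).

Lemma convex_hull_set1 x : convex_hull [set x] = [set x].
Proof.
apply: smallest_id; apply/convex_setP => _ _ t -> -> _ /=.
by rewrite -scalerDl addrC subrK scale1r.
Qed.

Lemma adjacent_neq I x y : adjacent I x y -> x != y.
Proof.
move=> [_ [[p [xyp pfree]] _]]; apply/eqP => xy.
have [i [j /eqP]] := aff_indep_neq pfree; apply.
move: xyp; rewrite -xy setUid convex_hull_set1 => xp.
by rewrite (xp i) (xp j).
Qed.

(** The edge lies in a facet, and its ends, being extreme in the body, are two
    of the three corners of that triangle. *)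
Lemma adjacent_edist I l x y : is_polytope I ->
  (forall F, is_kface I 2 F -> is_equilateral_triangle l F) ->
  is_vertex I x -> is_vertex I y -> adjacent I x y -> edist x y = l.
Proof.
move=> [[A /finite_seqP[s ->] IE] I3] facets [face_x _] [face_y _] xy.
have xNy := adjacent_neq xy; have [face_xy _] := xy.
have cI : convex_set I by rewrite IE; exact: convex_hull_convex.
have [F facetF eF] := edge_facet cI face_xy xNy IE I3.
have [[FI _ _] _] := facetF.
have [a [b [c [FE ab bc ca]]]] := facets F facetF.
have hull_I : convex_hull [set a; b; c] `<=` I by rewrite -FE.
have xabc : [set a; b; c] x.
  apply: (extreme_in_generators face_x hull_I); rewrite -FE.
  by apply: eF; apply: sub_gen_smallest; left.
have yabc : [set a; b; c] y.
  apply: (extreme_in_generators face_y hull_I); rewrite -FE.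
  by apply: eF; apply: sub_gen_smallest; right.
move: xNy; case: xabc => [[]|] ->; case: yabc => [[]|] ->; rewrite ?eqxx //;
  by rewrite edistC.
Qed.

End AdjacentDistance.

(** * Regular polygons *)

Section Turns.
Context {R : realType}.
Implicit Types (m j k : nat).

Definition turn m k : R := 2 * pi * k%:R / m%:R.

Lemma turnD m j k : turn m (j + k) = turn m j + turn m k.
Proof. by rewrite /turn natrD mulrDr mulrDl. Qed.

Lemma turn_full m k : (0 < m)%N -> turn m (k * m) = (pi *+ 2) *+ k.
Proof.
move=> m0; rewrite /turn natrM mulrA mulfK; last by rewrite pnatr_eq0 -lt0n.
by rewrite mulr_natl mulr_natr.
Qed.

Lemma cos_turn_mod m k : (0 < m)%N -> cos (turn m (k %% m)) = cos (turn m k).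
Proof.
move=> m0; rewrite {2}(divn_eq k m) addnC turnD turn_full //.
by rewrite (periodicn (@cosD2pi R)).
Qed.

Lemma sin_turn_mod m k : (0 < m)%N -> sin (turn m (k %% m)) = sin (turn m k).
Proof.
move=> m0; rewrite {2}(divn_eq k m) addnC turnD turn_full //.
by rewrite (periodicn (@sinD2pi R)).
Qed.

Lemma cos_turn_neq1 m k : (0 < k < m)%N -> cos (turn m k) != 1.
Proof.
move=> /andP[k0 km]; pose y : R := pi * (k%:R / m%:R).
have m0 : 0 < m%:R :> R by rewrite ltr0n (ltn_trans k0 km).
have siny : 0 < sin y.
  apply: sin_gt0_pi.
  rewrite mulr_gt0 ?pi_gt0 ?divr_gt0 ?ltr0n ?(ltn_trans k0 km) //=.
  by rewrite gtr_pMr ?pi_gt0 // ltr_pdivrMr // mul1r ltr_nat.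
have -> : turn m k = y *+ 2 by rewrite /turn /y; field; rewrite gt_eqF.
by rewrite cos_mulr2n cos2sin2; apply/eqP => e; nra.
Qed.

End Turns.

Section RegularPolygon.
Context {R : realType} {n m : nat}.
Variables (c : 'rV[R]_n) (r : R) (q : 'I_m -> 'rV[R]_n).
Hypothesis regular : is_regular_polygon c r q.

Let m_gt0 : (0 < m)%N. Proof. by case: regular => /ltnW/ltnW. Qed.

Let r_gt0 : 0 < r. Proof. by case: regular. Qed.

Let dot_radii j k :
  dot (q j - c) (q k - c) = r ^+ 2 * cos (turn m k - turn m j).
Proof.
have [_ _ [e1 [e2 [e11 e22 e12 qE]]]] := regular.
have e21 : dot e2 e1 = 0 by rewrite dotC.
rewrite !qE /= ![c + _]addrC !addrK !dotE e11 e22 e12 e21 cosB -/(turn m j).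
rewrite -/(turn m k); ring.
Qed.

Let enorm_radius k : enorm (q k - c) = r.
Proof.
by rewrite /enorm dot_radii subrr cos0 mulr1 sqrtr_sqr gtr0_norm.
Qed.

Lemma regular_polygon_edist k : edist c (q k) = r.
Proof. by rewrite edistC; exact: enorm_radius. Qed.

Lemma regular_polygon_inj : injective q.
Proof.
suff lt_neq (j k : 'I_m) : (j < k)%N -> q j <> q k.
  move=> j k qjk; apply: val_inj => /=.
  by case: (ltngtP j k) => // jk;
    [have := lt_neq _ _ jk|have := lt_neq _ _ jk (esym qjk)].
move=> jk qjk; have := dot_radii j j; have := dot_radii j k; rewrite -qjk => ->.
rewrite subrr cos0 => /mulfI; rewrite expf_eq0 gt_eqF // => /(_ isT).
have -> : turn m k - turn m j = turn m (k - j) :> R.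
  by rewrite -{1}(subnK (ltnW jk)) turnD addrK.
apply/eqP/cos_turn_neq1.
by rewrite subn_gt0 jk (leq_ltn_trans (leq_subr j k)) ?ltn_ord.
Qed.

Lemma regular_polygon_angle k : angle (q k - c) (q (ordS k) - c) = turn m 1.
Proof.
rewrite /angle dot_radii !enorm_radius -expr2 mulrC mulKf; last first.
  by rewrite expf_eq0 gt_eqF.
rewrite cosB cos_turn_mod // sin_turn_mod // -cosB -addn1 addnC turnD addrK.
apply: cosK; rewrite in_itv /= /turn mulr1.
have [m2 _ _] := regular.
have m0 : 0 < m%:R :> R by rewrite ltr0n.
rewrite divr_ge0 ?mulr_ge0 ?pi_ge0 ?(ltW m0) //= ler_pdivrMr // mulrC.
by rewrite ler_pM2l ?pi_gt0 // (ler_nat _ 2) ltnW.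
Qed.

End RegularPolygon.

Section Rotation.
Context {R : realType} {n : nat}.
Implicit Types (w : nat -> 'rV[R]_n).

(** The cosines and sines of the multiples of [phi] satisfy the same two-term
    recurrence, so only the first two terms have to be matched: [e1] is [w 0]
    normalised and [e2] the normalised part of [w 1] orthogonal to it. *)
Lemma rotation_orbit w (r phi : R) : 0 < r -> sin phi != 0 ->
  dot (w 0%N) (w 0%N) = r ^+ 2 -> dot (w 1%N) (w 1%N) = r ^+ 2 ->
  dot (w 0%N) (w 1%N) = r ^+ 2 * cos phi ->
  (forall k, w k.+2 = (2 * cos phi) *: w k.+1 - w k) ->
  exists e1 e2 : 'rV[R]_n, [/\ dot e1 e1 = 1, dot e2 e2 = 1, dot e1 e2 = 0 &
    forall k, w k = r *: (cos (phi * k%:R) *: e1 + sin (phi * k%:R) *: e2)].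
Proof.
move=> r0 s0 w00 w11 w01 wS.
have r_neq0 : r != 0 by rewrite gt_eqF.
exists (r^-1 *: w 0%N), ((r * sin phi)^-1 *: (w 1%N - cos phi *: w 0%N)).
have w10 : dot (w 1%N) (w 0%N) = r ^+ 2 * cos phi by rewrite dotC.
have cs := cos2Dsin2 phi; split.
- by rewrite !dotE w00; field.
- rewrite !dotE w00 w11 w01 w10.
  have -> : 1 = (1 - cos phi ^+ 2) / sin phi ^+ 2.
    by rewrite -sin2cos2 divff // expf_neq0.
  by field; rewrite s0.
- by rewrite !dotE w00 w01; field; rewrite s0.
set e1 := r^-1 *: w 0%N; set e2 := _ *: (w 1%N - _).
pose W k := r *: (cos (phi * k%:R) *: e1 + sin (phi * k%:R) *: e2).
have W0 : w 0%N = W 0%N.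
  rewrite /W /e1 /e2 mulr0 cos0 sin0; apply/rowP => i; rewrite !mxE; field.
  by rewrite s0.
have W1 : w 1%N = W 1%N.
  rewrite /W /e1 /e2 mulr1; apply/rowP => i; rewrite !mxE; field.
  by rewrite s0.
have WS k : W k.+2 = (2 * cos phi) *: W k.+1 - W k.
  have k1 : phi * k.+1%:R = phi * k%:R + phi by rewrite -natr1; ring.
  have k2 : phi * k.+2%:R = phi * k%:R + phi + phi.
    by rewrite -natr1 mulrDr k1 mulr1.
  have ec : cos (phi * k.+2%:R) =
      2 * cos phi * cos (phi * k.+1%:R) - cos (phi * k%:R).
    transitivity (2 * cos phi * cos (phi * k.+1%:R)
        - cos (phi * k%:R) * (cos phi ^+ 2 + sin phi ^+ 2)).
      by rewrite k2 k1 !cosD sinD; ring.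
    by rewrite cs mulr1.
  have es : sin (phi * k.+2%:R) =
      2 * cos phi * sin (phi * k.+1%:R) - sin (phi * k%:R).
    transitivity (2 * cos phi * sin (phi * k.+1%:R)
        - sin (phi * k%:R) * (cos phi ^+ 2 + sin phi ^+ 2)).
      by rewrite k2 k1 !sinD cosD; ring.
    by rewrite cs mulr1.
  by rewrite /W ec es; apply/rowP => i; rewrite !mxE; ring.
move=> k; suff [] : w k = W k /\ w k.+1 = W k.+1 by [].
by elim: k => [|k [IH1 IH2]]; split=> //; rewrite wS WS IH1 IH2.
Qed.

End Rotation.

Section GoldenCosines.
Context {R : realType}.

(** Three times 36 degrees and twice 36 degrees add up to a straight angle, so
    their cosines are opposite; this factors through the root -1. *)
Lemma cos_pi5 : 4 * cos (pi / 5) ^+ 2 - 2 * cos (pi / 5) - 1 = 0 :> R.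
Proof.
pose x : R := pi / 5; rewrite -/x; have pi0 := pi_gt0 R.
have t0 : 0 < cos x by apply: cos_gt0_pihalf; rewrite /x; lra.
have e2 : cos (x *+ 2) = 2 * cos x ^+ 2 - 1 by rewrite cos_mulr2n; ring.
have e3 : cos (x *+ 2 + x) = 4 * cos x ^+ 3 - 3 * cos x.
  rewrite cosD e2 sin_mulr2n.
  have -> : (cos x * sin x) *+ 2 * sin x = 2 * cos x * sin x ^+ 2 by ring.
  by rewrite sin2cos2; ring.
have e : cos (x *+ 2 + x) = - cos (x *+ 2).
  have -> : x *+ 2 + x = - (x *+ 2) + pi by rewrite /x; field.
  by rewrite cosDpi cosN.
have /eqP : (cos x + 1) * (4 * cos x ^+ 2 - 2 * cos x - 1) = 0.
  transitivity (cos (x *+ 2 + x) + cos (x *+ 2)); first by rewrite e3 e2; ring.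
  by rewrite e addNr.
by rewrite mulf_eq0 gt_eqF ?addr_gt0 //= => /eqP.
Qed.

Lemma cos_3pi5 : cos (3 * (pi / 5)) = 1 / 2 - cos (pi / 5) :> R.
Proof.
have -> : 3 * (pi / 5) = - ((pi / 5) *+ 2) + pi :> R by field.
by rewrite cosDpi cosN cos_mulr2n; have := cos_pi5; lra.
Qed.

(** The minimal polynomial of the cosine of 36 degrees has as its other root
    the cosine of 108 degrees. *)
Lemma golden_cos (t : R) : 4 * t ^+ 2 - 2 * t - 1 = 0 ->
  t = cos (turn 10 1) \/ t = cos (turn 10 3).
Proof.
move=> te.
have -> : turn 10 1 = pi / 5 :> R by rewrite /turn; field.
have -> : turn 10 3 = 3 * (pi / 5) :> R by rewrite /turn; field.
rewrite cos_3pi5; have := cos_pi5; set s := cos _ => se.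
have /eqP : (t - s) * (t - (1 / 2 - s)) = 0.
  have -> : (t - s) * (t - (1 / 2 - s)) = (4 * t ^+ 2 - 2 * t - 1) / 4
     - (4 * s ^+ 2 - 2 * s - 1) / 4 by field.
  by rewrite te se !mul0r subrr.
by rewrite mulf_eq0 !subr_eq0 => /orP[] /eqP; [left|right].
Qed.

End GoldenCosines.

(** * The zigzag around the axis *)

Section Zigzag.
Context {R : realType}.
Notation pt := 'rV[R]_3.
Variables (n : pt) (z : nat -> pt) (a c : R).
Hypothesis dot_nn : dot n n = a.
Hypothesis dot_zz : forall k, dot (z k) (z k) = a.
Hypothesis dot_zS : forall k, dot (z k) (z k.+1) = c.
Hypothesis dot_zSS : forall k, dot (z k) (z k.+2) = c.
Hypothesis dot_nz : forall k, dot n (z k) = (-1) ^+ k * c.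
Hypothesis lt_ca : c < a.

Let tau := c / (a - c).
Let w k := midpoint (z k) (z k.+1).

Let dot_Sz k : dot (z k.+1) (z k) = c. Proof. by rewrite dotC. Qed.
Let dot_SSz k : dot (z k.+2) (z k) = c. Proof. by rewrite dotC. Qed.
Let dot_zn k : dot (z k) n = (-1) ^+ k * c. Proof. by rewrite dotC. Qed.

Let signK k : (-1) ^+ k * (-1) ^+ k = 1 :> R.
Proof. by rewrite -expr2 sqrr_sign. Qed.

Let tauE : tau * (a - c) = c.
Proof. by rewrite mulfVK // subr_eq0 gt_eqF. Qed.

(** If [a + c = 0], consecutive vectors are opposite and [z 2 = z 0], which
    contradicts [c < a]. *)
Let ac_gt0 : 0 < a + c.
Proof.
have zD k : dot (z k + z k.+1) (z k + z k.+1) = 2 * (a + c).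
  by rewrite !dotE !dot_zz dot_zS dot_Sz; ring.
have : 0 <= a + c by have := dot_ge0 (z 0%N + z 1%N); rewrite zD; lra.
rewrite le0r => /predU1P[ac0|//].
have opp k : z k.+1 = - z k.
  apply/eqP; rewrite -addr_eq0 addrC; apply/eqP/dot_eq0.
  by rewrite zD ac0 mulr0.
have := dot_zSS 0; rewrite !opp opprK dot_zz => ca.
by have := lt_ca; rewrite ca ltxx.
Qed.

(** The difference is orthogonal to the other two vectors, which are
    independent because [a ^+ 2 - c ^+ 2] is positive. *)
Let zigzag_triple_neq0 k : triple n (z k.+1) (z k.+2 - z k) != 0.
Proof.
set D := z k.+2 - z k.
have nD : dot n D = 0 by rewrite /D !dotE !dot_nz !exprS; ring.
have zD : dot (z k.+1) D = 0 by rewrite /D !dotE dot_zS dot_Sz subrr.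
have DD : dot D D = 2 * (a - c).
  by rewrite /D !dotE !dot_zz dot_zSS dot_SSz; ring.
suff : 0 < triple n (z k.+1) D ^+ 2 by move/lt0r_neq0; rewrite sqrf_eq0.
have -> : triple n (z k.+1) D ^+ 2 = 2 * (a - c) * ((a - c) * (a + c)).
  rewrite triple_gram nD zD DD dot_nn dot_zz dot_nz.
  transitivity (2 * (a - c) *
      (a * a - ((-1) ^+ k.+1 * (-1) ^+ k.+1) * (c * c))).
    by ring.
  by rewrite signK; ring.
have ac : 0 < a - c by rewrite subr_gt0.
by rewrite !mulr_gt0.
Qed.

(** In the plane orthogonal to [n], the vectors [z k] and [z k.+2] have the same
    length and the same dot product with [z k.+1], so each is the mirror image
    of the other in the line of [z k.+1].  The multiple of [n] corrects the
    components along the axis.  The defect is checked to be orthogonal to [n],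
    [z k.+1] and [z k.+2 - z k]. *)
Let zigzag_step k :
  z k.+2 = (2 * tau) *: (z k.+1 + (-1) ^+ k *: n) - z k.
Proof.
apply/eqP; rewrite -subr_eq0; apply/eqP.
have te := tauE; have s2 := signK k; set s := (-1) ^+ k in s2 *.
apply: (orthogonal3_eq0 (zigzag_triple_neq0 k)).
- rewrite !dotE !dot_zn dot_nn !exprS -/s.
  transitivity (2 * s * (c - tau * (a - c))); first by ring.
  by rewrite te subrr mulr0.
- rewrite !dotE !dot_zz dot_Sz dot_zS dot_nz exprS -/s.
  transitivity (2 * (c - tau * (a - s * s * c))); first by ring.
  by rewrite s2 mul1r te subrr mulr0.
- rewrite !dotE !dot_zz dot_zS dot_Sz dot_zSS dot_SSz !dot_nz !exprS -/s; ring.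
Qed.

(** The step relation paired with [z k], where the third dot product is again
    [c]. *)
Let gap_eq : a + c = 4 * tau * c.
Proof.
have := dot_SSz 0; rewrite zigzag_step !dotE dot_zz dot_Sz dot_nz expr0 => e.
lra.
Qed.

(** Eliminating [a] between [gap_eq] and the definition of [tau]. *)
Let tau_golden : 4 * tau ^+ 2 - 2 * tau - 1 = 0.
Proof.
apply: (@mulIf _ (a - c)); first by rewrite subr_eq0 gt_eqF.
rewrite mul0r; transitivity
    ((4 * tau - 2) * (tau * (a - c)) - (a - c)); first by ring.
by rewrite tauE; have := gap_eq; lra.
Qed.

Lemma zigzag_midpoint_orthogonal k : dot (w k) n = 0.
Proof. by rewrite /w /midpoint !dotE !dot_zn exprS; ring. Qed.

(** The case [m = 3] occurs for the vertices of the great icosahedron. *)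
Lemma zigzag_midpoints : exists (r : R) (m : nat) (e1 e2 : pt),
  [/\ 0 < r, m = 1%N \/ m = 3%N,
      [/\ dot e1 e1 = 1, dot e2 e2 = 1 & dot e1 e2 = 0] &
      forall k, w k = r *: (cos (turn 10 (m * k)) *: e1
                            + sin (turn 10 (m * k)) *: e2)].
Proof.
pose r := Num.sqrt ((a + c) / 2).
have r_gt0 : 0 < r by rewrite sqrtr_gt0 divr_gt0.
have r2 : r ^+ 2 = (a + c) / 2 by rewrite sqr_sqrtr // divr_ge0 // ltW.
have wS k : w k.+2 = (2 * tau) *: w k.+1 - w k.
  rewrite /w /midpoint (zigzag_step k.+1) (zigzag_step k) exprS.
  by apply/rowP => i; rewrite !mxE; ring.
have w_sqr k : dot (w k) (w k) = r ^+ 2.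
  by rewrite r2 /w /midpoint !dotE !dot_zz dot_zS dot_Sz; field.
have w01 : dot (w 0%N) (w 1%N) = r ^+ 2 * tau.
  rewrite r2 /w /midpoint !dotE !dot_zz !dot_zS dot_zSS.
  have t2 : tau * tau = (2 * tau + 1) / 4 by have := tau_golden; nra.
  transitivity ((4 * tau * c + 2 * c) / 4).
    by rewrite -gap_eq; field.
  rewrite gap_eq; transitivity (2 * (tau * tau) * c); last by field.
  by rewrite t2; field.
have [m [m13 tauE']] : exists m, (m = 1%N \/ m = 3%N) /\ tau = cos (turn 10 m).
  by have [] := golden_cos tau_golden; [exists 1%N|exists 3%N]; auto.
have sin_m : sin (turn 10 m) != 0 :> R.
  have pi0 := pi_gt0 R; apply/lt0r_neq0/sin_gt0_pi; rewrite /turn.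
  by case: m13 => ->; lra.
rewrite tauE' in w01 wS.
have [e1 [e2 [e11 e22 e12 wE]]] :=
  rotation_orbit r_gt0 sin_m (w_sqr 0%N) (w_sqr 1%N) w01 wS.
exists r, m, e1, e2; split=> // k; rewrite wE.
suff -> : turn 10 m * k%:R = turn 10 (m * k) :> R by [].
by rewrite /turn natrM; ring.
Qed.

End Zigzag.

(** * The ten midpoints *)

Section Equator.
Context {R : realType}.
Notation pt := 'rV[R]_3.
Implicit Types (N S O : pt) (U L : 'Z_5 -> pt).

(** Consecutive terms are the ends of the cross-edges, in the order in which
    the closed path of the ten cross-edges runs through them. *)
Definition zigzag U L (k : nat) : pt :=
  if odd k then L (k./2)%:R else U (k./2)%:R.

Lemma zigzag_even U L k : zigzag U L k.*2 = U k%:R.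
Proof. by rewrite /zigzag odd_double doubleK. Qed.

Lemma zigzag_odd U L k : zigzag U L k.*2.+1 = L k%:R.
Proof. by rewrite /zigzag /= odd_double uphalf_double. Qed.

Lemma nat_parity_ind (Q : nat -> Prop) :
  (forall k, Q k.*2) -> (forall k, Q k.*2.+1) -> forall k, Q k.
Proof.
move=> Q0 Q1 k; rewrite -(odd_double_half k).
by case: (odd k); rewrite ?add1n ?add0n.
Qed.

Lemma triangle_family_midpoints N S U L :
  cross_midpoint @` triangle_family N S U L =
  range (fun k => midpoint (zigzag U L k) (zigzag U L k.+1)).
Proof.
apply/seteqP; split=> [_ [_ [[i _ <-]|[i _ <-]] <-]|_ [k _ <-]].
- exists (i : nat).*2 => //.
  by rewrite zigzag_even zigzag_odd natr_Zp.
- exists (nat_of_ord (i - 1)).*2.+1 => //.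
  rewrite zigzag_odd -doubleS zigzag_even -natr1 natr_Zp subrK.
  by rewrite /midpoint addrC.
elim/nat_parity_ind: k => k.
- exists (F_S S U L k%:R); first by left; exists k%:R.
  by rewrite zigzag_even zigzag_odd.
- exists (F_N N U L k.+1%:R); first by right; exists k.+1%:R.
  rewrite zigzag_odd -doubleS zigzag_even /cross_midpoint /= -natr1 addrK.
  by rewrite /midpoint addrC.
Qed.

Lemma labelled_midpoints I l O N S U L :
  0 < l -> is_regular_icosahedron I l -> is_center I O ->
  is_labelling I O N S U L ->
  let z k := zigzag U L k - O in
  let w k := midpoint (z k) (z k.+1) in
  (forall k, dot (w k) (N - O) = 0) /\
  exists (r : R) (m : nat) (e1 e2 : pt),
  [/\ 0 < r, m = 1%N \/ m = 3%N,
      [/\ dot e1 e1 = 1, dot e2 e2 = 1 & dot e1 e2 = 0] &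
      forall k, w k = r *: (cos (turn 10 (m * k)) *: e1
                            + sin (turn 10 (m * k)) *: e2)].
Proof.
move=> l0 [[polyI _] _ facets] centerO labels z w.
have vtx x : ([set N; S] `|` range U `|` range L) x -> is_vertex I x.
  by rewrite -(label_vertices labels).
have vN : is_vertex I N by apply: vtx; left; left; left.
have vS : is_vertex I S by apply: vtx; left; left; right.
have vU i : is_vertex I (U i) by apply: vtx; left; right; exists i.
have vL i : is_vertex I (L i) by apply: vtx; right; exists i.
pose a := dot (N - O) (N - O); pose c := a - l ^+ 2 / 2.
have dot_vertex x : is_vertex I x -> dot (x - O) (x - O) = a.
  move=> vx; rewrite /a -!edist_sqr.
  by rewrite !(edistC _ O) (centerO x N).
have dot_adjacent x y : is_vertex I x -> is_vertex I y -> adjacent I x y ->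
    dot (x - O) (y - O) = c.
  move=> vx vy xy; have := edist_sqr x y.
  rewrite (adjacent_edist polyI facets vx vy xy).
  rewrite (_ : x - y = (x - O) - (y - O)); last first.
    by apply/rowP => i; rewrite !mxE; ring.
  have := dot_vertex x vx; have := dot_vertex y vy.
  move: (x - O) (y - O) => u v vv uu.
  rewrite !dotE uu vv (dotC v u) /c; lra.
have SN : S - O = - (N - O).
  rewrite -(label_opposite labels) /midpoint.
  by apply/rowP => i; rewrite !mxE; field.
have NU i : dot (N - O) (U i - O) = c.
  by apply: dot_adjacent => //; apply/(label_upper labels); exists i.
have NL i : dot (N - O) (L i - O) = - c.
  rewrite -[N - O]opprK -SN dotNl; congr (- _).
  by apply: dot_adjacent => //; apply/(label_lower labels); exists i.
have UL i : dot (U i - O) (L i - O) = c.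
  by apply: dot_adjacent => //; apply/(label_cross labels); left.
have LU i : dot (L i - O) (U (i + 1) - O) = c.
  rewrite dotC; apply: dot_adjacent => //; apply/(label_cross labels).
  by right; rewrite addrK.
have UU i : dot (U i - O) (U (i + 1) - O) = c.
  by apply: dot_adjacent => //; exact: (label_upper_cycle labels).
have LL i : dot (L i - O) (L (i + 1) - O) = c.
  by apply: dot_adjacent => //; exact: (label_lower_cycle labels).
have dot_zz k : dot (z k) (z k) = a.
  by rewrite /z; elim/nat_parity_ind: k => k;
    rewrite ?zigzag_even ?zigzag_odd dot_vertex.
have dot_zS k : dot (z k) (z k.+1) = c.
  rewrite /z; elim/nat_parity_ind: k => k.
    by rewrite zigzag_even zigzag_odd.
  by rewrite zigzag_odd -doubleS zigzag_even -natr1.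
have dot_zSS k : dot (z k) (z k.+2) = c.
  rewrite /z; elim/nat_parity_ind: k => k; rewrite -doubleS.
    by rewrite !zigzag_even -natr1.
  by rewrite !zigzag_odd -natr1.
have dot_nz k : dot (N - O) (z k) = (-1) ^+ k * c.
  rewrite /z; elim/nat_parity_ind: k => k.
    by rewrite zigzag_even NU -signr_odd odd_double mul1r.
  by rewrite zigzag_odd NL -signr_odd /= odd_double mulN1r.
have lt_ca : c < a by rewrite /c gtrBl divr_gt0 // exprn_gt0.
split=> [k|]; first exact: (zigzag_midpoint_orthogonal dot_nz).
exact: (zigzag_midpoints (erefl a) dot_zz dot_zS dot_zSS dot_nz lt_ca).
Qed.

End Equator.

Theorem theorem4 (R : realType) (I : set 'rV[R]_3) (l : R) (O N S : 'rV[R]_3)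
    (U L : 'Z_5 -> 'rV[R]_3)
    (l_gt0 : 0 < l)
    (icoI : is_regular_icosahedron I l)
    (centerO : is_center I O)
    (labels : is_labelling I O N S U L) :
  let P := cross_midpoint @` triangle_family N S U L in
  let Pi := equatorial_plane O N S in
  [/\ P `<=` Pi,
      P #= `I_10 &
      exists r : R,
        [/\ 0 < r,
            P `<=` circle Pi O r &
            exists q : 'I_10 -> 'rV[R]_3,
              [/\ range q = P,
                  is_regular_polygon O r q &
                  forall k : 'I_10,
                    angle (q k - O) (q (ordS k) - O) = degrees 36]]].
Proof.
move=> P Pi.
have [w_orth [r [m [e1 [e2 [r0 m13 e_orth wE]]]]]] :=
  labelled_midpoints l_gt0 icoI centerO labels.
set z := fun k => zigzag U L k - O in w_orth wE.
have PE : P = range (fun k => O + midpoint (z k) (z k.+1)).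
  rewrite /P triangle_family_midpoints; congr (_ @` _); apply/funext => k.
  by rewrite /midpoint /z; apply/rowP => i; rewrite !mxE; field.
pose W k := r *: (cos (turn 10 k) *: e1 + sin (turn 10 k) *: e2).
have W_mod k : W (k %% 10)%N = W k by rewrite /W cos_turn_mod ?sin_turn_mod.
pose q (k : 'I_10) := O + W k.
have [e11 e22 e12] := e_orth.
have regular_q : is_regular_polygon O r q by split=> //; exists e1, e2; split.
have range_q : range q = P.
  rewrite PE; apply/seteqP; split=> _ [k _ <-].
    (* The inverses of 1 and 3 modulo 10 are 1 and 7. *)
    have [m' mm'] : exists m', (m * m' = 1 %[mod 10])%N.
      by case: m13 => ->; [exists 1%N|exists 7%N].
    exists (m' * k)%N => //; rewrite wE -/(W _) -W_mod mulnA -modnMml.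
    by rewrite mm' modnMml mul1n W_mod.
  exists (inord (m * k %% 10)) => //.
  by rewrite /q inordK ?ltn_pmod // W_mod wE.
have P_Pi : P `<=` Pi.
  rewrite PE => _ [k _ <-]; rewrite /Pi /equatorial_plane /= addrC addKr.
  suff -> : N - S = 2 *: (N - O) by rewrite dotZr w_orth mulr0.
  rewrite -(label_opposite labels) /midpoint.
  by apply/rowP => i; rewrite !mxE; field.
split=> //.
  rewrite -range_q; apply: card_eq_trans (inj_card_eq _) _.
    by move=> j k _ _; exact: (regular_polygon_inj regular_q).
  by rewrite card_eq_sym card_II.
exists r; split=> //.
  move=> x Px; split; first exact: P_Pi.
  move: Px; rewrite -range_q => -[k _ <-].
  exact: (regular_polygon_edist regular_q).
exists q; split=> // k; rewrite (regular_polygon_angle regular_q).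
by rewrite /turn /degrees; field.
Qed.
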